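(* For every integer $d\ge 1$, the degree of the Hilbert series of $R_{4,9,d}$ is $2(d-1)$, and its leading coefficient is bounded from below by $1$.
   Context: Let $\Bbbk$ be a field of characteristic zero. $R_{4,9,d}=\Bbbk[x_1,x_2,x_3,x_4]/(\ell_1^d,\ldots,\ell_9^d)$, where $\ell_1,\ldots,\ell_9$ are general linear forms, i.e. the statement holds for all $(\ell_1,\dots,\ell_9)$ in some nonempty Zariski open subset of the space of $9$-tuples of linear forms. The Hilbert series of a standard graded algebra $A$ is $\sum_i\dim_\Bbbk(A_i)t^i$; here it is a polynomial, and its leading coefficient is the coefficient in its top degree. *)

(* Defs.v *)
From HB Require Import structures.
From mathcomp Require Import all_boot all_order all_algebra.
From mathcomp Require Import generic_quotient ring_quotient.
From mathcomp Require Import mpoly.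
From mathcomp Require boolp.

Set Implicit Arguments.
Unset Strict Implicit.
Unset Printing Implicit Defensive.

Import GRing.Theory.

Local Open Scope ring_scope.
Local Open Scope quotient_scope.

(* The ideal (g_0, ..., g_(m-1)), as a boolean predicate (through asbool) so
   that the quotient constructions of ring_quotient apply to it. *)
Definition gen_ideal (k : fieldType) (n m : nat) (g : 'I_m -> {mpoly k[n]}) :
    {pred {mpoly k[n]}} :=
  fun f => boolp.asbool
    (exists c : 'I_m -> {mpoly k[n]}, f = \sum_(j < m) c j * g j).

Section IdealQuotient.
Variables (k : fieldType) (n m : nat) (g : 'I_m -> {mpoly k[n]}).

Lemma gen_idealP (f : {mpoly k[n]}) :
  reflect (exists c : 'I_m -> {mpoly k[n]}, f = \sum_(j < m) c j * g j)
          (f \in gen_ideal g).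
Proof. exact: boolp.asboolP. Qed.

Lemma gen_ideal_zmod_closed : zmod_closed (gen_ideal g).
Proof.
split=> [|f h].
  apply/gen_idealP; exists (fun=> 0).
  by rewrite big1 // => j _; rewrite mul0r.
move=> /gen_idealP[c ->] /gen_idealP[e ->]; apply/gen_idealP.
exists (fun j => c j - e j).
by rewrite -sumrB; apply: eq_bigr => j _; rewrite mulrBl.
Qed.

HB.instance Definition _ :=
  GRing.isZmodClosed.Build {mpoly k[n]} (gen_ideal g) gen_ideal_zmod_closed.

Lemma gen_idealMl (a f : {mpoly k[n]}) :
  f \in gen_ideal g -> a * f \in gen_ideal g.
Proof.
case/gen_idealP=> c ->; apply/gen_idealP; exists (fun j => a * c j).
by rewrite mulr_sumr; apply: eq_bigr => j _; rewrite mulrA.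
Qed.

(* The quotient k[x_0, ..., x_(n-1)] / (g_0, ..., g_(m-1)), with its k-module
   structure.  Its ring structure plays no role for the Hilbert series, and the
   library only provides it when the ideal is known to be proper. *)
Definition mpoly_quot : Type := Quotient.quot (gen_ideal g).

HB.instance Definition _ := GRing.Zmodule.on mpoly_quot.
HB.instance Definition _ := ZmodQuotient.on mpoly_quot.

Definition mpoly_quot_pi (f : {mpoly k[n]}) : mpoly_quot :=
  \pi_(Quotient.quot (gen_ideal g)) f.

Definition mpoly_quot_scale (a : k) (x : mpoly_quot) : mpoly_quot :=
  mpoly_quot_pi (a *: repr x).

Lemma mpoly_quot_piP (f h : {mpoly k[n]}) :
  reflect (mpoly_quot_pi f = mpoly_quot_pi h) (f - h \in gen_ideal g).
Proof. by rewrite Quotient.idealrBE; apply: eqP. Qed.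

Lemma mpoly_quot_piZ (a : k) (f : {mpoly k[n]}) :
  mpoly_quot_scale a (mpoly_quot_pi f) = mpoly_quot_pi (a *: f).
Proof.
apply/mpoly_quot_piP; rewrite -scalerBr -mul_mpolyC; apply: gen_idealMl.
by apply/mpoly_quot_piP; rewrite /mpoly_quot_pi reprK.
Qed.

Lemma mpoly_quot_piD (f h : {mpoly k[n]}) :
  mpoly_quot_pi (f + h) = mpoly_quot_pi f + mpoly_quot_pi h.
Proof. exact: (raddfD (\pi_(Quotient.quot (gen_ideal g)))). Qed.

Lemma mpoly_quot_piK (x : mpoly_quot) : mpoly_quot_pi (repr x) = x.
Proof. exact: reprK. Qed.

Fact mpoly_quot_scaleA a b x :
  mpoly_quot_scale a (mpoly_quot_scale b x) = mpoly_quot_scale (a * b) x.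
Proof. by rewrite -[x]mpoly_quot_piK !mpoly_quot_piZ scalerA. Qed.

Fact mpoly_quot_scale1 : left_id 1 mpoly_quot_scale.
Proof. by move=> x; rewrite -[x]mpoly_quot_piK mpoly_quot_piZ scale1r. Qed.

Fact mpoly_quot_scaleDr : right_distributive mpoly_quot_scale +%R.
Proof.
move=> a x y; rewrite -[x]mpoly_quot_piK -[y]mpoly_quot_piK.
by rewrite -mpoly_quot_piD !mpoly_quot_piZ scalerDr mpoly_quot_piD.
Qed.

Fact mpoly_quot_scaleDl x : {morph mpoly_quot_scale^~ x : a b / a + b}.
Proof.
move=> a b; rewrite -[x]mpoly_quot_piK.
by rewrite !mpoly_quot_piZ scalerDl mpoly_quot_piD.
Qed.

HB.instance Definition _ := GRing.Zmodule_isLmodule.Build k mpoly_quot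
  mpoly_quot_scaleA mpoly_quot_scale1 mpoly_quot_scaleDr mpoly_quot_scaleDl.

(* The degree-i component of the quotient (for homogeneous g). *)
Definition mpoly_quot_piece (i : nat) (x : mpoly_quot) : Prop :=
  exists2 f : {mpoly k[n]}, f \is i.-homog & x = mpoly_quot_pi f.

End IdealQuotient.

(* The subspace W of V has a basis with N elements. *)
Definition has_dim (k : fieldType) (V : lmodType k) (W : V -> Prop) (N : nat) :
    Prop :=
  exists b : 'I_N -> V,
    (forall j, W (b j)) /\
    (forall v, W v ->
       exists! c : {ffun 'I_N -> k}, v = \sum_(j < N) c j *: b j).

(* The Hilbert series of k[x_0, ..., x_(n-1)] / (g_0, ..., g_(m-1)) is the
   polynomial H. *)
Definition is_hilbert_series (k : fieldType) (n m : nat)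
    (g : 'I_m -> {mpoly k[n]}) (H : {poly nat}) : Prop :=
  forall i : nat, has_dim (@mpoly_quot_piece k n m g i) (H`_i)%R.

Definition linear_form (k : fieldType) (n : nat) (a : 'rV[k]_n) :
    {mpoly k[n]} :=
  \sum_(i < n) a 0 i *: 'X_i.

(* The space of r-tuples of linear forms in n variables is the affine space of
   r x n matrices of coefficients, row j being the j-th form; its Zariski open
   sets are the unions of nonvanishing loci of polynomials in the r * n
   entries. *)
Definition zariski_open (k : fieldType) (r n : nat) (U : 'M[k]_(r, n) -> Prop) :
    Prop :=
  exists S : {mpoly k[r * n]} -> Prop,
    forall a, U a <-> exists2 f, S f & f.@[fun t => mxvec a 0 t] != 0.

Definition for_general_linear_forms (k : fieldType) (r n : nat)
    (P : ('I_r -> {mpoly k[n]}) -> Prop) : Prop :=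
  exists U : 'M[k]_(r, n) -> Prop,
    [/\ zariski_open U, exists a, U a &
        forall a, U a -> P (fun j => linear_form (row j a))].

(* Main.v *)
Require Import Defs.
From HB Require Import structures.
From mathcomp Require Import all_boot all_order all_algebra.
From mathcomp Require Import ssrcomplements mpoly ring zify.

(* Write e = d - 1.

   Nonvanishing in degree 2e: ten quadratic monomials and nine points give a
   nonzero quadric q vanishing at the coefficient vectors v of the nine forms.
   The directional derivative D_v satisfies D_v^2 q = 2 q(v) = 0, hence
   D_v^(e+1) (q^e) = 0.  So under the apolarity pairing <g, f> = g(D) f the
   whole ideal pairs to 0 with q^e, whereas a monomial of q^e does not.

   Vanishing in degree 2e + 1: surjectivity of multiplication onto that degree
   is the nonvanishing of a maximal minor, so one tuple suffices, and the eight
   forms x_i + x_j, x_i - x_j with i in {0, 1} and j in {2, 3} already work.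
   Each of them involves exactly one of x_0, x_1, so the product of the two
   partial derivatives maps the ideal for d onto the ideal for d - 1, and by
   induction on d only elements of its kernel remain, that is, polynomials
   missing x_0 or x_1.  The same argument with x_2, x_3 leaves polynomials in
   x_i, x_j alone, which are combinations of the products
   (x_i + x_j)^p (x_i - x_j)^q with p + q = 2e + 1, so p > e or q > e.
   Geometrically, a surface of degree 2d - 1 with points of multiplicity d at
   the eight points contains the lines, then the planes, joining them. *)

Set Implicit Arguments.
Unset Strict Implicit.
Unset Printing Implicit Defensive.

Import GRing.Theory.

Local Open Scope ring_scope.

(** * Derivatives of homogeneous polynomials and of powers of linear forms *)

Lemma dhomog_coeffP (R : nzRingType) n d (p : {mpoly R[n]}) :
  (forall m, p@_m != 0 -> mdeg m = d) -> p \is d.-homog.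
Proof. by move=> h; apply/dhomogP => m; rewrite mcoeff_msupp => /h. Qed.

Section Derivations.
Variables (R : nzRingType) (n : nat).
Implicit Types (f g : {mpoly R[n]}) (i j : 'I_n).

Lemma dhomog_mderiv i d f : f \is d.+1.-homog -> f^`M(i) \is d.-homog.
Proof.
move=> hf; apply: dhomog_coeffP => m; rewrite mcoeff_mderiv.
have [fm0|fm _] := eqVneq (f@_(m + U_(i))) 0; first by rewrite fm0 mul0rn eqxx.
move/dhomogP/(_ (m + U_(i))%MM): hf; rewrite mcoeff_msupp => /(_ fm).
by rewrite /= mdegD mdeg1 addn1 => -[].
Qed.

Lemma mderiv_dhomog0 i f : f \is 0.-homog -> f^`M(i) = 0.
Proof.
move=> hf; apply/mpolyP => m; rewrite mcoeff_mderiv mcoeff0.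
by rewrite (dhomog_nemf_coeff hf) ?mul0rn //= mdegD mdeg1 addn1.
Qed.

Lemma dhomog0C f : f \is 0.-homog -> f = (f@_0)%:MP.
Proof.
move=> hf; apply/mpolyP => m; rewrite mcoeffC; have [->|nz] := eqVneq m 0%MM.
  by rewrite mulr1.
by rewrite mulr0 (dhomog_nemf_coeff hf) //= mdeg_eq0.
Qed.

End Derivations.

Section LinearForms.
Variables (k : fieldType) (n : nat).
Implicit Types (v : 'rV[k]_n) (i : 'I_n).

Lemma dhomog_linear_form v : linear_form v \is 1.-homog.
Proof.
by apply: rpred_sum => i _; apply: rpredZ; rewrite dhomogX /= mdeg1.
Qed.

Lemma mderiv_linear_form v i : (linear_form v)^`M(i) = (v 0 i)%:MP.
Proof.
rewrite /linear_form raddf_sum /= (bigD1 i) //= big1 ?addr0 => [|j ji].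
  rewrite mderivZ mderivX mnm1E eqxx scale1r.
  by rewrite -[X in (X - _)%MM]add0m addmK mpolyX0 -mul_mpolyC mulr1.
by rewrite mderivZ mderivX mnm1E (negbTE ji) scale0r scaler0.
Qed.

Lemma mderiv_linear_formX v i e :
  (linear_form v ^+ e.+1)^`M(i) = (e.+1%:R * v 0 i) *: linear_form v ^+ e.
Proof.
elim: e => [|e IH]; first by rewrite mderiv_linear_form mul1r -mul_mpolyC mulr1.
rewrite exprS mderivM IH mderiv_linear_form mul_mpolyC -scalerAr -exprS.
by rewrite -scalerDl -[e.+2%:R]natr1 mulrDl mul1r addrC.
Qed.

End LinearForms.

(** * Formal integration in one variable *)

Section Antiderivative.
Variables (k : fieldType) (n : nat).
Hypothesis char0 : [pchar k] =i pred0.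
Implicit Types (f g : {mpoly k[n]}) (i j : 'I_n).

Lemma natrS_neq0 e : e.+1%:R != 0 :> k.
Proof. by rewrite ((pcharf0P k).1 char0). Qed.

(** The antiderivative of [f] in [X_i] all of whose terms are divisible by [X_i]. It is a right
    inverse of the derivative once the exponents are invertible, and it commutes with the other
    partial derivatives. *)
Definition mint i f : {mpoly k[n]} :=
  \sum_(m <- msupp f) (f@_m / (m i).+1%:R) *: 'X_[m + U_(i)].

Lemma mcoeff_mint i f m :
  (mint i f)@_m = if m i is e.+1 then f@_(m - U_(i)) / e.+1%:R else 0.
Proof.
rewrite /mint raddf_sum /=.
case mi: (m i) => [|e].
  apply: big1 => m' _; rewrite mcoeffZ mcoeffX.
  case: eqP => [mm|_]; last by rewrite mulr0.
  by move: mi; rewrite -mm mnmDE mnm1E eqxx addn1.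
have le_m : (U_(i) <= m)%MM.
  by apply/mnm_lepP => j; rewrite mnm1E; case: eqP => // <-; rewrite mi.
have mi' : (m - U_(i))%MM i = e by rewrite mnmBE mnm1E eqxx mi subn1.
have eqm m' : m' != (m - U_(i))%MM -> (m' + U_(i) == m)%MM = false.
  by move=> ne; apply: contraNF ne => /eqP <-; rewrite addmK.
have [fm|fm] := boolP ((m - U_(i))%MM \in msupp f).
  rewrite (bigD1_seq (m - U_(i))%MM) //= big1 ?addr0 => [|m' ne].
    by rewrite mcoeffZ mcoeffX submK // eqxx mulr1 mi'.
  by rewrite mcoeffZ mcoeffX eqm ?mulr0.
rewrite (memN_msupp_eq0 fm) mul0r big_seq; apply: big1 => m' fm'.
rewrite mcoeffZ mcoeffX eqm ?mulr0 //.
by apply: contraNneq fm => <-.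
Qed.

Lemma mintK i : cancel (mint i) (mderiv i).
Proof.
move=> f; apply/mpolyP => m; rewrite mcoeff_mderiv mcoeff_mint.
rewrite mnmDE mnm1E eqxx addn1 addmK -[LHS]mulr_natr divfK //.
exact: natrS_neq0.
Qed.

Lemma mderiv_mint i j f : i != j -> (mint i f)^`M(j) = mint i f^`M(j).
Proof.
move=> ij; apply/mpolyP => m; rewrite mcoeff_mderiv !mcoeff_mint mnmDE mnm1E.
rewrite eq_sym (negbTE ij) addn0.
case mi: (m i) => [|e]; first by rewrite mul0rn.
rewrite mcoeff_mderiv mnmBE mnm1E (negbTE ij) subn0 mulrnAl.
have -> // : (m + U_(j) - U_(i) = m - U_(i) + U_(j))%MM.
apply/mnmP => x; rewrite !(mnmBE, mnmDE) addnBAC //.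
by rewrite mnm1E; case: eqP => // <-; rewrite mi.
Qed.

Lemma mint0 i : mint i 0 = 0.
Proof. by rewrite /mint msupp0 big_nil. Qed.

Lemma dhomog_mint i d f : f \is d.-homog -> mint i f \is d.+1.-homog.
Proof.
move=> hf; rewrite /mint big_seq; apply: rpred_sum => m /(dhomog_mf hf) /= <-.
by apply: rpredZ; rewrite dhomogX /= mdegD mdeg1 addn1.
Qed.

End Antiderivative.

(** * Cofactors of powers of linear forms, and reduction by two derivatives *)

Section PowerSpan.
Variables (k : fieldType) (n : nat) (J : finType) (v : J -> 'rV[k]_n).
Hypothesis char0 : [pchar k] =i pred0.
Implicit Types (V : {set 'I_n}) (A : pred J) (f g h : {mpoly k[n]}).

(** In characteristic zero: only variables of [V] occur in [f]. Vanishing derivatives make closure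
    under products, derivatives and integrals immediate. *)
Definition in_vars V f := forall i, i \notin V -> f^`M(i) = 0.

Lemma in_vars0 V : in_vars V 0.
Proof. by move=> i _; rewrite raddf0. Qed.

Lemma in_varsD V f g : in_vars V f -> in_vars V g -> in_vars V (f + g).
Proof. by move=> hf hg i iV; rewrite raddfD /= hf ?hg ?addr0. Qed.

Lemma in_varsZ V a f : in_vars V f -> in_vars V (a *: f).
Proof. by move=> hf i iV; rewrite mderivZ hf ?scaler0. Qed.

Lemma in_varsB V f g : in_vars V f -> in_vars V g -> in_vars V (f - g).
Proof. by move=> hf hg i iV; rewrite raddfB /= hf ?hg ?subr0. Qed.

Lemma in_varsM V f g : in_vars V f -> in_vars V g -> in_vars V (f * g).
Proof. by move=> hf hg i iV; rewrite mderivM hf ?hg // mul0r mulr0 addr0. Qed.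

Lemma in_varsX V f e : in_vars V f -> in_vars V (f ^+ e).
Proof.
move=> hf; elim: e => [|e IH]; last by rewrite exprS; apply: in_varsM.
by move=> i _; rewrite expr0 -mpolyC1 mderivC.
Qed.

Lemma in_vars_sum (I : Type) (r : seq I) (P : pred I) F V :
  (forall x, P x -> in_vars V (F x)) -> in_vars V (\sum_(x <- r | P x) F x).
Proof.
by move=> h; elim/big_ind: _ => //; [apply: in_vars0 | apply: in_varsD].
Qed.

Lemma in_vars_mderiv V i f : in_vars V f -> in_vars V f^`M(i).
Proof. by move=> hf j jV; rewrite mderiv_comm hf // raddf0. Qed.

Lemma in_vars_mint V i f : i \in V -> in_vars V f -> in_vars V (mint i f).
Proof.
move=> iV hf j jV; rewrite mderiv_mint ?hf ?mint0 //.
by apply: contraNneq jV => <-.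
Qed.

Lemma in_vars_linear_form V (w : 'rV[k]_n) :
  (forall i, i \notin V -> w 0 i = 0) -> in_vars V (linear_form w).
Proof. by move=> hw i iV; rewrite mderiv_linear_form hw // mpolyC0. Qed.

(* [e] is the degree of the cofactors, so that [d = e + 1] and the elements
   have degree [2 * d - 1]. *)
Definition power_span A V e f : Prop :=
  exists c : J -> {mpoly k[n]},
    [/\ forall j, c j \is e.-homog, forall j, in_vars V (c j) &
        f = \sum_(j | A j) c j * linear_form (v j) ^+ e.+1].

Lemma power_spanD A V e f g :
  power_span A V e f -> power_span A V e g -> power_span A V e (f + g).
Proof.
move=> [b [bh bV ->]] [c [ch cV ->]]; exists (fun j => b j + c j); split.
- by move=> j; apply: rpredD.
- by move=> j; apply: in_varsD.
by rewrite -big_split; apply: eq_bigr => j _; rewrite mulrDl.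
Qed.

Lemma power_spanZ A V e a f : power_span A V e f -> power_span A V e (a *: f).
Proof.
move=> [c [ch cV ->]]; exists (fun j => a *: c j); split.
- by move=> j; apply: rpredZ.
- by move=> j; apply: in_varsZ.
by rewrite scaler_sumr; apply: eq_bigr => j _; rewrite scalerAl.
Qed.

Lemma power_span_sub A A' V V' e f : {subset A <= A'} -> V \subset V' ->
  power_span A V e f -> power_span A' V' e f.
Proof.
move=> AA' VV' [c [ch cV ->]]; exists (fun j => if A j then c j else 0); split.
- by move=> j; case: ifP => // _; apply: rpred0.
- move=> j i iV'; case: ifP => _; last by rewrite raddf0.
  by apply: cV; apply: contraNN iV'; apply: (subsetP VV').
rewrite [RHS](bigID A) /=.
rewrite [X in _ + X]big1 ?addr0 => [|j /andP[_ Aj]]; last first.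
  by rewrite (negbTE Aj) mul0r.
apply: eq_big => [j|j Aj]; last by rewrite Aj.
by rewrite andbC; case Aj: (A j) => //; rewrite (AA' j Aj : A' j).
Qed.

(* Divide by [w 0 i] and correct the error, which involves only [h^`M(i)]. *)
Lemma mderiv_surj_power (w : 'rV[k]_n) V i : w 0 i != 0 ->
  in_vars V (linear_form w) -> forall e h m, h \is e.-homog -> in_vars V h ->
  exists h', [/\ h' \is e.-homog, in_vars V h' &
    h * linear_form w ^+ m = (h' * linear_form w ^+ m.+1)^`M(i)].
Proof.
move=> wi wV; have nz m : m.+1%:R * w 0 i != 0.
  by rewrite mulf_neq0 ?natrS_neq0.
elim=> [|e IH] h m hh hV.
  (* A constant cofactor has zero derivative, so there is no error to correct. *)
  exists ((m.+1%:R * w 0 i)^-1 *: h).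
  split; [exact: rpredZ | exact: in_varsZ |].
  rewrite mderivM mderivZ mderiv_dhomog0 // scaler0 mul0r add0r.
  by rewrite mderiv_linear_formX -scalerAr -scalerAl scalerA divff ?scale1r.
have [g [gh gV gE]] :=
  IH h^`M(i) m.+1 (dhomog_mderiv i hh) (in_vars_mderiv i hV).
exists ((m.+1%:R * w 0 i)^-1 *: (h - g * linear_form w)); split.
- apply/rpredZ/rpredB => //; rewrite -addn1.
  by apply: dhomogM => //; apply: dhomog_linear_form.
- by apply/in_varsZ/in_varsB => //; apply: in_varsM.
rewrite -scalerAl mderivZ mulrBl -mulrA -exprS raddfB /= -gE.
rewrite mderivM mderiv_linear_formX addrAC subrr add0r -scalerAr scalerA.
by rewrite mulVf ?scale1r.
Qed.

(** As [w 0 i = 0], the derivative in [i] treats powers of the form as constants and acts on the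
    cofactor alone. So the cofactor is integrated in [i] first, and then [mderiv_surj_power] undoes
    the derivative in [j]. *)
Lemma mderiv2_surj_power (w : 'rV[k]_n) V i j : i \in V ->
  w 0 i = 0 -> w 0 j != 0 -> in_vars V (linear_form w) ->
  forall e h m, h \is e.-homog -> in_vars V h ->
  exists h', [/\ h' \is e.+1.-homog, in_vars V h' &
    h * linear_form w ^+ m = (h' * linear_form w ^+ m.+1)^`M(i)^`M(j)].
Proof.
move=> iV wi wj wV e h m hh hV.
have [g [gh gV gE]] :=
  mderiv_surj_power wj wV m (dhomog_mint i hh) (in_vars_mint iV hV).
exists g; split=> //; rewrite mderiv_comm -gE mderivM (mintK char0).
by case: m gE => [|m] gE;
  rewrite ?mderiv_linear_formX ?wi ?mulr0 ?scale0r ?mulr0 ?expr0 ?addr0 //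
    -mpolyC1 mderivC mulr0 addr0.
Qed.

(* [f |-> f^`M(i)^`M(i')] maps the span for [e.+1] onto the span for [e]. *)
Lemma power_span_step A V i i' : i != i' -> i \in V -> i' \in V ->
  (forall j, A j -> in_vars V (linear_form (v j))) ->
  (forall j, A j -> (v j 0 i == 0) (+) (v j 0 i' == 0)) ->
  (forall e f, f \is (e.*2.+1).-homog -> in_vars (V :\ i) f ->
     power_span A V e f) ->
  (forall e f, f \is (e.*2.+1).-homog -> in_vars (V :\ i') f ->
     power_span A V e f) ->
  forall e f, f \is (e.*2.+1).-homog -> in_vars V f -> power_span A V e f.
Proof.
move=> ii' iV i'V AV Aii' hi hi'.
(* If the mixed derivative vanishes, [f] is the sum of
   [f - mint i f^]M(i)[, which is free of]X_i[, and]mint i f^[M(i)], which is free of [X_i']. *)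
have split_kernel e f : f \is (e.*2.+1).-homog -> in_vars V f ->
    f^`M(i)^`M(i') = 0 -> power_span A V e f.
  move=> fh fV fii'; rewrite -[f](subrK (mint i f^`M(i))).
  have mh : mint i f^`M(i) \is (e.*2.+1).-homog.
    by apply/dhomog_mint/dhomog_mderiv.
  have mV : in_vars V (mint i f^`M(i)) by apply/in_vars_mint/in_vars_mderiv.
  apply: power_spanD.
    apply: hi; first exact: rpredB.
    move=> j; rewrite !inE negb_and negbK => /orP[/eqP->|jV].
      by rewrite raddfB /= (mintK char0) subrr.
    by exact: (in_varsB fV mV).
  apply: hi' => // j; rewrite !inE negb_and negbK.
  case/orP=> [/eqP->|]; last exact: mV.
  by rewrite mderiv_mint // fii' mint0.
elim=> [|e IH] f fh fV.
  (* For [e = 0] the degree is 1, so two derivatives give zero. *)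
  apply: split_kernel => //.
  by apply/mderiv_dhomog0/dhomog_mderiv.
have [||c [ch cV fE]] := IH f^`M(i)^`M(i').
- by apply/dhomog_mderiv/dhomog_mderiv.
- by apply/in_vars_mderiv/in_vars_mderiv.
(* Each form involves exactly one of the two variables; that one plays the role of [j] in
   [mderiv2_surj_power], the other that of [i]. *)
have lift j : exists h, A j -> [/\ h \is e.+1.-homog, in_vars V h &
    c j * linear_form (v j) ^+ e.+1
      = (h * linear_form (v j) ^+ e.+2)^`M(i)^`M(i')].
  have [Aj|] := boolP (A j); last by exists 0.
  have := Aii' j Aj; case: (eqVneq (v j 0 i) 0) => [vi|vi].
    rewrite addTb => vi'.
    have [h hP] := mderiv2_surj_power iV vi vi' (AV j Aj) e.+1 (ch j) (cV j).
    by exists h.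
  rewrite addFb => /eqP vi'.
  have [h [hh hV hE]] :=
    mderiv2_surj_power i'V vi' vi (AV j Aj) e.+1 (ch j) (cV j).
  by exists h => _; rewrite mderiv_comm.
have [h hP] := boolp.choice lift.
pose g := \sum_(j | A j) h j * linear_form (v j) ^+ e.+2.
have gS : power_span A V e.+1 g.
  exists (fun j => if A j then h j else 0); split.
  - by move=> j; case: ifP => [/hP[]//|_]; apply: rpred0.
  - by move=> j; case: ifP => [/hP[]//|_]; apply: in_vars0.
  by apply: eq_bigr => j Aj; rewrite Aj.
(* [g] has the same mixed derivative as [f], so [f - g] lies in the kernel. *)
rewrite -[f](subrK g); apply: power_spanD => //; apply: split_kernel.
- apply: rpredB => //; rewrite /g; apply: rpred_sum => j /hP[hh _ _].
  have -> : (e.+1.*2.+1 = e.+1 + 1 * e.+2)%N by rewrite mul1n addnS -addnn.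
  by apply: dhomogM => //; apply/dhomogMn/dhomog_linear_form.
- apply: in_varsB => //; apply: in_vars_sum => j Aj; have [_ hV _] := hP j Aj.
  by apply: in_varsM => //; apply/in_varsX/AV.
rewrite !raddfB /= fE /g (raddf_sum (mderiv i)) /= (raddf_sum (mderiv i')).
by rewrite -sumrB big1 // => j /hP[_ _ hE]; rewrite /= -hE subrr.
Qed.

End PowerSpan.

(** * Monomials in a restricted set of variables *)

Section InVars.
Variables (k : fieldType) (n : nat).
Hypothesis char0 : [pchar k] =i pred0.
Implicit Types (f : {mpoly k[n]}) (V : {set 'I_n}).

Lemma in_vars_subset V V' f : V \subset V' -> in_vars V f -> in_vars V' f.
Proof.
move=> VV' hf i iV'; apply: hf; apply: contraNN iV'; exact: (subsetP VV').
Qed.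

Lemma in_vars_msupp V f m i :
  in_vars V f -> m \in msupp f -> i \notin V -> m i = 0%N.
Proof.
move=> hf mf /hf fi0; case mi: (m i) => [//|e].
have le_m : (U_(i) <= m)%MM.
  by apply/mnm_lepP => j; rewrite mnm1E; case: eqP => // <-; rewrite mi.
move/mpolyP/(_ (m - U_(i))%MM): fi0.
rewrite mcoeff_mderiv mcoeff0 submK // -[LHS]mulr_natr => /eqP.
by rewrite mulf_eq0 (negbTE (natrS_neq0 char0 _)) orbF mcoeff_eq0 mf.
Qed.

Lemma mpolyX_pair (m : 'X_{1..n}) (i j : 'I_n) : i != j ->
  (forall l, l \notin [set i; j] -> m l = 0%N) ->
  'X_[m] = 'X_i ^+ m i * 'X_j ^+ m j :> {mpoly k[n]}.
Proof.
move=> ij hm; rewrite !mpolyXn -mpolyXD; congr 'X_[_].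
apply/mnmP => l; rewrite mnmDE !mulmnE !mnm1E.
have [<-|il] := eqVneq i l; first by rewrite eq_sym (negbTE ij) mul1n addn0.
have [<-|jl] := eqVneq j l; first by rewrite mul1n.
by rewrite hm // !inE negb_or ![l == _]eq_sym il jl.
Qed.

Lemma mdeg_pair (m : 'X_{1..n}) (i j : 'I_n) : i != j ->
  (forall l, l \notin [set i; j] -> m l = 0%N) -> mdeg m = (m i + m j)%N.
Proof.
move=> ij hm; rewrite mdegE (bigD1 i) //= (bigD1 j) /=; last by rewrite eq_sym.
rewrite big1 ?addn0 // => l /andP[li lj].
by rewrite hm // !inE negb_or li lj.
Qed.

End InVars.

(** * Eight special forms whose powers span degree [2e + 1] *)

Section SpecialForms.
Variable k : fieldType.
Hypothesis char0 : [pchar k] =i pred0.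

Definition iv (s : bool) : 'I_4 :=
  if s then @Ordinal 4 1 isT else @Ordinal 4 0 isT.
Definition jv (t : bool) : 'I_4 :=
  if t then @Ordinal 4 3 isT else @Ordinal 4 2 isT.

(** Two points on each of four edges of the coordinate tetrahedron: the first two booleans choose
    the edge, the third the sign. *)
Definition special_form (x : bool * bool * bool) : 'rV[k]_4 :=
  delta_mx 0 (iv x.1.1) + (-1) ^+ x.2 *: delta_mx 0 (jv x.1.2).

Lemma linear_form_special x :
  linear_form (special_form x) = 'X_(iv x.1.1) + (-1) ^+ x.2 *: 'X_(jv x.1.2).
Proof.
rewrite /linear_form (eq_bigr (fun i =>
    (i == iv x.1.1)%:R *: 'X_i + ((-1) ^+ x.2 * (i == jv x.1.2)%:R) *: 'X_i));
  last by move=> i _; rewrite !mxE !eqxx /= -scalerDl.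
rewrite big_split; congr (_ + _).
  rewrite (bigD1 (iv x.1.1)) //= eqxx scale1r big1 ?addr0 // => i /negbTE->.
  by rewrite scale0r.
rewrite (bigD1 (jv x.1.2)) //= eqxx mulr1 big1 ?addr0 // => i /negbTE->.
by rewrite mulr0 scale0r.
Qed.

Lemma special_form_iv x s : (special_form x 0 (iv s) == 0) = (x.1.1 != s).
Proof.
case: x => [[s' t] e]; rewrite !mxE /=.
by case: s; case: s'; case: t; rewrite /= ?mulr0 ?addr0 ?oner_eq0 ?eqxx.
Qed.

Lemma special_form_jv x t : (special_form x 0 (jv t) == 0) = (x.1.2 != t).
Proof.
case: x => [[s t'] e]; rewrite !mxE /=.
by case: s; case: t; case: t';
  rewrite /= ?mulr0 ?addr0 ?eqxx // add0r mulr1 signr_eq0.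
Qed.

Lemma in_vars_special_form (V : {set 'I_4}) x :
  iv x.1.1 \in V -> jv x.1.2 \in V ->
  in_vars V (linear_form (special_form x)).
Proof.
move=> iV jV; apply: in_vars_linear_form => i i_notin; rewrite !mxE /=.
have -> : (i == iv x.1.1) = false by apply: contraNF i_notin => /eqP->.
have -> : (i == jv x.1.2) = false by apply: contraNF i_notin => /eqP->.
by rewrite mulr0 addr0.
Qed.

Lemma power_span_line s t e (f : {mpoly k[4]}) :
  f \is (e.*2.+1).-homog -> in_vars [set iv s; jv t] f ->
  power_span special_form [pred x | (x.1.1 == s) && (x.1.2 == t)]
    [set iv s; jv t] e f.
Proof.
set V := [set _; _]; set A := [pred x | _]; move=> fh fV.
have ij : iv s != jv t by case: s {fV} @V @A; case: t.
pose x : {mpoly k[4]} := 'X_(iv s); pose y : {mpoly k[4]} := 'X_(jv t).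
have n2 : (2%:R : k) != 0 by apply: natrS_neq0.
(* Induction on the number [a + b] of factors [x] and [y] not yet rewritten, using
   [2x = (x + y) + (x - y)] and [2y = (x + y) - (x - y)]. *)
have key N : forall a b p q, (a + b = N)%N -> (p + q + a + b = e.*2.+1)%N ->
    power_span special_form A V e
      ((x + y) ^+ p * (x - y) ^+ q * x ^+ a * y ^+ b).
  have uE (c : bool) :
      linear_form (special_form (s, t, c)) = x + (-1) ^+ c *: y.
    by rewrite linear_form_special.
  have uV (c : bool) : in_vars V (x + (-1) ^+ c *: y).
    by rewrite -uE; apply: in_vars_special_form; rewrite !inE eqxx ?orbT.
  have uh (c : bool) : x + (-1) ^+ c *: y \is 1.-homog.
    by rewrite -uE; apply: dhomog_linear_form.
  have one (c : bool) g : g \is e.-homog -> in_vars V g ->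
      power_span special_form A V e (g * (x + (-1) ^+ c *: y) ^+ e.+1).
    move=> gh gV; exists (fun z => if z == (s, t, c) then g else 0); split.
    - by move=> z; case: ifP => // _; apply: rpred0.
    - by move=> z; case: ifP => // _; apply: in_vars0.
    rewrite (bigD1 (s, t, c)) ?inE /= ?eqxx // big1 ?addr0 ?uE // => z.
    by case/andP=> _ /negbTE->; rewrite mul0r.
  elim: N => [|N IH] a b p q.
    move=> /eqP; rewrite addn_eq0 => /andP[/eqP-> /eqP->].
    rewrite !addn0 !expr0 !mulr1 => pq.
    (* As [p + q = 2e + 1], one exponent is at least [e + 1]; splitting off that power leaves a
       cofactor of degree exactly [e]. *)
    have [pe|qe] : (e < p)%N \/ (e < q)%N by lia.
      have := one false ((x + y) ^+ (p - e.+1) * (x - y) ^+ q).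
      rewrite expr0 scale1r mulrAC -exprD subnK //; apply.
        have {2}<- : (1 * (p - e.+1) + 1 * q)%N = e by lia.
        move: (uh false) (uh true).
        rewrite expr0 expr1 scale1r scaleN1r => h1 h2.
        by apply: dhomogM; apply: dhomogMn.
      move: (uV false) (uV true); rewrite expr0 expr1 scale1r scaleN1r => h1 h2.
      by apply: in_varsM; apply: in_varsX.
    have := one true ((x + y) ^+ p * (x - y) ^+ (q - e.+1)).
    rewrite expr1 scaleN1r -mulrA -exprD subnK //; apply.
      have {2}<- : (1 * p + 1 * (q - e.+1))%N = e by lia.
      move: (uh false) (uh true); rewrite expr0 expr1 scale1r scaleN1r => h1 h2.
      by apply: dhomogM; apply: dhomogMn.
    move: (uV false) (uV true); rewrite expr0 expr1 scale1r scaleN1r => h1 h2.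
    by apply: in_varsM; apply: in_varsX.
  have half (g : {mpoly k[4]}) : g = 2%:R^-1 *: (g + g).
    by rewrite -mulr2n -scaler_nat scalerA mulVf ?scale1r.
  case: a => [|a] abN pqab.
    case: b abN pqab => [//|b] abN pqab.
    have -> : (x + y) ^+ p * (x - y) ^+ q * x ^+ 0 * y ^+ b.+1 =
      2%:R^-1 *: ((x + y) ^+ p.+1 * (x - y) ^+ q * x ^+ 0 * y ^+ b +
        (-1) *: ((x + y) ^+ p * (x - y) ^+ q.+1 * x ^+ 0 * y ^+ b)).
      by rewrite [LHS]half scaleN1r; congr (_ *: _); rewrite !exprS; ring.
    apply/power_spanZ/power_spanD; last apply: power_spanZ; apply: IH; lia.
  have -> : (x + y) ^+ p * (x - y) ^+ q * x ^+ a.+1 * y ^+ b =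
    2%:R^-1 *: ((x + y) ^+ p.+1 * (x - y) ^+ q * x ^+ a * y ^+ b +
      ((x + y) ^+ p * (x - y) ^+ q.+1 * x ^+ a * y ^+ b)).
    by rewrite [LHS]half; congr (_ *: _); rewrite !exprS; ring.
  apply/power_spanZ/power_spanD; apply: IH; lia.
rewrite [f]mpolyE big_seq; elim/big_ind: _ => [|g h|m mf].
(* The empty sum is a zero multiple of [x ^+ e.*2.+1], which [key] puts in the span. *)
- rewrite -(scale0r (x ^+ e.*2.+1)); apply: power_spanZ.
  have := key e.*2.+1 e.*2.+1 0 0 0%N; rewrite !expr0 !mul1r mulr1.
  by apply; rewrite ?addn0.
- exact: power_spanD.
apply: power_spanZ.
have m0 l : l \notin V -> m l = 0%N by apply: (in_vars_msupp char0 fV).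
rewrite (mpolyX_pair k ij m0) -[_ * _]mul1r mulrA.
have := key (m (iv s) + m (jv t))%N (m (iv s)) (m (jv t)) 0 0 erefl.
rewrite !expr0 mulr1; apply; rewrite !add0n -(mdeg_pair ij m0).
by move/dhomogP: fh => /(_ _ mf).
Qed.

(** The four forms involving [iv s] contain exactly one of the variables 2 and 3 each, so
    [power_span_step] applies to this pair; dropping either variable leaves the case of a line. *)
Lemma power_span_plane s e (f : {mpoly k[4]}) :
  f \is (e.*2.+1).-homog -> in_vars [set iv s; jv false; jv true] f ->
  power_span special_form [pred x | x.1.1 == s]
    [set iv s; jv false; jv true] e f.
Proof.
set V := [set _; _; _]; set A := [pred x | _].
have line t : forall e f, f \is (e.*2.+1).-homog ->
    in_vars (V :\ jv (~~ t)) f ->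
    power_span special_form A V e f.
  move=> {e f} e f fh fV.
  have Vt : V :\ jv (~~ t) \subset [set iv s; jv t].
    apply/subsetP => i; rewrite !inE; case: t {fV} => /=;
      by case: (i == iv s); case: (i == jv false); case: (i == jv true).
  have := power_span_line fh (in_vars_subset Vt fV).
  apply: power_span_sub; first by move=> x /andP[].
  apply/subsetP => i; rewrite !inE.
  by case: t {fV Vt} => /orP[]->; rewrite ?orbT.
apply: (power_span_step char0 (i := jv false) (i' := jv true)) => //;
  rewrite ?inE ?eqxx ?orbT //.
- move=> x /eqP xs; apply: in_vars_special_form.
    by rewrite !inE xs eqxx.
  by rewrite !inE; case: x.1.2; rewrite eqxx ?orbT.
- by move=> x _; rewrite !special_form_jv; case: x.1.2.
- exact: (line true).
- exact: (line false).
Qed.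

(** The same reduction with the variables 0 and 1; dropping either leaves the case of a plane. *)
Lemma power_span_special e (f : {mpoly k[4]}) :
  f \is (e.*2.+1).-homog -> power_span special_form predT [set: 'I_4] e f.
Proof.
have plane s : forall e f, f \is (e.*2.+1).-homog ->
    in_vars ([set: 'I_4] :\ iv (~~ s)) f ->
    power_span special_form predT [set: 'I_4] e f.
  move=> {e f} e f fh fV.
  have Vs : [set: 'I_4] :\ iv (~~ s) \subset [set iv s; jv false; jv true].
    apply/subsetP => i; rewrite !inE andbT.
    by case: s {fV}; case: i => [] [|[|[|[|]]]].
  have := power_span_plane fh (in_vars_subset Vs fV).
  by apply: power_span_sub => //; apply: subsetT.
move=> fh; apply: (power_span_step char0 (i := iv false) (i' := iv true)) fh _;
  rewrite ?in_setT //.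
- by move=> x _ i; rewrite inE.
- by move=> x _; rewrite !special_form_iv; case: x.1.1.
- exact: (plane true).
- exact: (plane false).
- by move=> i; rewrite inE.
Qed.

End SpecialForms.

(** * Directional derivatives and the apolarity pairing *)

Section Apolarity.
Variables (k : fieldType) (n : nat).
Implicit Types (f g q : {mpoly k[n]}) (v : 'rV[k]_n) (m : 'X_{1..n}).

Definition dirder v f : {mpoly k[n]} := \sum_(i < n) v 0 i *: f^`M(i).

Lemma dirder_is_linear v : linear (dirder v).
Proof.
move=> a f g; rewrite /dirder scaler_sumr -big_split; apply: eq_bigr => i _.
by rewrite linearP scalerDr !scalerA mulrC.
Qed.

HB.instance Definition _ v := GRing.isLinear.Build k {mpoly k[n]} {mpoly k[n]} _
  (dirder v) (dirder_is_linear v).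

Lemma dirderM v f g : dirder v (f * g) = dirder v f * g + f * dirder v g.
Proof.
rewrite /dirder mulr_suml mulr_sumr -big_split; apply: eq_bigr => i _.
by rewrite mderivM scalerDr scalerAl -scalerAr.
Qed.

Lemma dirderC v a : dirder v a%:MP = 0.
Proof. by apply: big1 => i _; rewrite mderivC scaler0. Qed.

Lemma dhomog_dirder v d f : f \is d.+1.-homog -> dirder v f \is d.-homog.
Proof. by move=> hf; apply: rpred_sum => i _; apply/rpredZ/dhomog_mderiv. Qed.

(** Euler's identity: at the point [v] itself, the derivative along [v] is the sum of the
    [X_i^]-derivatives weighted by the coordinates, checked monomial by monomial. *)
Lemma euler_meval v d f : f \is d.-homog -> (dirder v f).@[v 0] = f.@[v 0] *+ d.
Proof.
move=> hf; rewrite [in LHS](mpolyE f) [in RHS](mpolyE f).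
rewrite (linear_sum (dirder v)) !(raddf_sum (meval (v 0))) /= -sumrMnl !big_seq.
apply: eq_bigr => m /(dhomog_mf hf) /= <-.
rewrite linearZ /= !mevalZ -mulrnAr; congr (_ * _).
rewrite mevalX /dirder raddf_sum /= mdegE -sumrMnr.
apply: eq_bigr => i _; rewrite mderivX !mevalZ mevalX.
rewrite mulrCA mulr_natl; case mi: (m i) => [|c]; first by rewrite !mulr0n.
congr (_ *+ _); rewrite (bigD1 i) //= [RHS](bigD1 i) //= mulrA.
rewrite mnmBE mnm1E eqxx mi subn1 -exprS; congr (_ * _).
by apply: eq_bigr => j ji; rewrite mnmBE mnm1E eq_sym (negbTE ji) subn0.
Qed.

(** Euler's identity applied twice gives the value [2 q(v) = 0] at [v], and the second derivative of
    a quadric is constant. *)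
Lemma dirder2_quadric v q : q \is 2.-homog -> q.@[v 0] = 0 ->
  dirder v (dirder v q) = 0.
Proof.
move=> hq q0; have h1 := dhomog_dirder v hq; have h0 := dhomog_dirder v h1.
have := euler_meval v h1; rewrite (euler_meval v hq) q0 !mul0rn.
by rewrite (dhomog0C h0) mevalC => ->; rewrite mpolyC0.
Qed.

Lemma iter_dirderM v f g e : dirder v f = 0 ->
  iter e (dirder v) (f * g) = f * iter e (dirder v) g.
Proof.
by move=> f0; elim: e => //= e ->; rewrite dirderM f0 mul0r add0r.
Qed.

(** One derivative turns [q^(e+1)] into [(e+1) q^e D q]. Since [D q] is itself killed by [D], it
    acts as a scalar, and each derivative lowers the exponent of [q] by one. *)
Lemma iter_dirderX v q : dirder v (dirder v q) = 0 ->
  forall e c, (e < c)%N -> iter c (dirder v) (q ^+ e) = 0.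
Proof.
move=> q2; have derX e : dirder v (q ^+ e.+1) = dirder v q * (q ^+ e *+ e.+1).
  elim: e => [|e IH]; first by rewrite mulr1.
  rewrite exprS dirderM IH mulrCA -mulrDr; congr (_ * _).
  by rewrite mulrnAr -exprS -mulrS.
have iter0 c : iter c (dirder v) 0 = 0 by elim: c => //= c ->; rewrite linear0.
elim=> [|e IH] [|c] //= ec; rewrite -iterS iterSr; last first.
  rewrite derX iter_dirderM // -mulr_natl -mpolyC_nat.
  by rewrite iter_dirderM ?dirderC // IH // !mulr0.
by rewrite expr0 -mpolyC1 dirderC iter0.
Qed.

(** The second argument acts on the first as a differential operator, and the constant term is
    taken. *)
Definition apolar f g : k := \sum_(m <- msupp g) g@_m * (f^`M[m])@_0.

Lemma apolarwE d g f : (msize g <= d)%N ->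
  apolar f g = \sum_(m : 'X_{1..n < d}) g@_m * (f^`M[m])@_0.
Proof.
move=> gd; rewrite /apolar (big_mksub 'X_{1..n < d}) /=; first last.
- by move=> m /msize_mdeg_lt /leq_trans; apply.
- exact: msupp_uniq.
by rewrite big_rmcond //= => m /memN_msupp_eq0 ->; rewrite mul0r.
Qed.

Lemma apolarP a g h f : apolar f (a *: g + h) = a * apolar f g + apolar f h.
Proof.
pose d := maxn (msize (a *: g + h)) (maxn (msize g) (msize h)).
rewrite !(apolarwE (d := d)) ?leq_max ?leqnn ?orbT //.
rewrite mulr_sumr -big_split; apply: eq_bigr => m _ /=.
by rewrite mcoeffD mcoeffZ mulrDl mulrA.
Qed.

HB.instance Definition _ f := GRing.isLinear.Build k {mpoly k[n]} k *%R
  (apolar f) (fun a g h => apolarP a g h f).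

Lemma apolarX m f : apolar f 'X_[m] = (f^`M[m])@_0.
Proof. by rewrite /apolar msuppX big_seq1 mcoeffX eqxx mul1r. Qed.

(** Multiplication by a variable is adjoint to differentiation. Hence a power of a linear form is
    adjoint to an iterated directional derivative. *)
Lemma apolarXM i g f : apolar f ('X_i * g) = apolar f^`M(i) g.
Proof.
elim/mpolyind: g => [|a m g _ _ IH].
  by rewrite mulr0 /apolar msupp0 !big_nil.
rewrite mulrDr -scalerAr -mpolyXD !apolarP IH !apolarX.
by rewrite mderivmDm mderivmU1m.
Qed.

Lemma apolar_sumr (I : finType) g (c : I -> k) (F : I -> {mpoly k[n]}) :
  apolar (\sum_i c i *: F i) g = \sum_i c i * apolar (F i) g.
Proof.
rewrite /apolar (eq_bigr (fun m => \sum_i c i * (g@_m * ((F i)^`M[m])@_0))).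
  by rewrite exchange_big; apply: eq_bigr => i _; rewrite mulr_sumr.
move=> m _; rewrite linear_sum raddf_sum mulr_sumr; apply: eq_bigr => i _ /=.
by rewrite mderivmZ mcoeffZ mulrCA.
Qed.

Lemma apolar_linear_formM v g f :
  apolar f (linear_form v * g) = apolar (dirder v f) g.
Proof.
rewrite /linear_form mulr_suml linear_sum apolar_sumr; apply: eq_bigr => i _ /=.
by rewrite -scalerAl linearZ /= apolarXM.
Qed.

Lemma apolar_linear_formXM v e g f :
  apolar f (linear_form v ^+ e * g) = apolar (iter e (dirder v) f) g.
Proof.
elim: e f => [|e IH] f; first by rewrite mul1r.
by rewrite exprS -mulrA apolar_linear_formM IH iterSr.
Qed.

(** The value is the coefficient of [m] times a product of factorials, nonzero in characteristic
    zero. *)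
Lemma apolar_msupp_neq0 m f : [pchar k] =i pred0 -> m \in msupp f ->
  apolar f 'X_[m] != 0.
Proof.
move=> char0 mf; rewrite apolarX mcoeff_mderivm addm0 -[X in X != 0]mulr_natr.
rewrite mulf_neq0 -?mcoeff_msupp // ((pcharf0P k).1 char0) -lt0n.
by apply: prodn_gt0 => i; rewrite ffactnn fact_gt0.
Qed.

End Apolarity.

(** * A monomial of degree [2e] outside the ideal *)

Lemma quadric_through_points (k : fieldType) (n r : nat)
    (v : 'I_r -> 'rV[k]_n.+1) :
  (r < 'C(2 + n, 2))%N ->
  exists q : {mpoly k[n.+1]}, [/\ q != 0, q \is 2.-homog &
    forall j, q.@[v j 0] = 0].
Proof.
(* Evaluation at [r] points is linear on a space of dimension greater than [r], so its kernel is
   nonzero. *)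
move=> rn; pose ev (q : dhomog n.+1 k 2) : 'rV[k]_r := \row_j (val q).@[v j 0].
have ev_lin : linear ev.
  by move=> a p q; apply/rowP => j; rewrite !mxE /= mevalD mevalZ.
pose evL := HB.pack_for {linear dhomog n.+1 k 2 -> 'rV[k]_r} ev
  (GRing.isLinear.Build _ _ _ _ ev ev_lin).
pose phi := linfun evL.
have kerphi : (lker phi != 0)%VS.
  rewrite -dimv_eq0 -lt0n.
  have := limg_ker_dim phi fullv; rewrite capfv dimvf /=.
  have : (\dim (limg phi) <= r)%N.
    by apply: leq_trans (dimvS (subvf _)) _; rewrite dimvf /dim /= mul1n.
  rewrite /dim /=; lia.
have [q qker qn0] : exists2 q, q \in lker phi & q != 0.
  exists (vpick (lker phi)); first exact: memv_pick.
  by rewrite vpick0.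
exists (val q); split; first by apply: contraNneq qn0 => q0; apply/eqP/val_inj.
  exact: (valP q).
move=> j; move: qker; rewrite memv_ker lfunE /= => /eqP/rowP/(_ j).
by rewrite !mxE.
Qed.

Lemma monomial_notin_ideal (k : fieldType) (n r : nat)
    (v : 'I_r -> 'rV[k]_n.+1) e :
  [pchar k] =i pred0 -> (r < 'C(2 + n, 2))%N ->
  exists2 m : 'X_{1..n.+1}, mdeg m = e.*2 &
    'X_[m] \notin gen_ideal (fun j => linear_form (v j) ^+ e.+1).
Proof.
move=> char0 /(quadric_through_points v)[q [q0 qh qv]].
have F0 : q ^+ e != 0 by rewrite expf_neq0.
have mF := mlead_supp F0.
(* The leading monomial is a definite choice in the support of [q ^+ e]; it pairs nontrivially with
   [q ^+ e], whereas every element of the ideal pairs to zero. *)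
exists (mlead (q ^+ e)).
  by move: (dhomogMn e qh) => /dhomogP/(_ _ mF) /= ->; rewrite mul2n.
apply: contraTN isT => /gen_idealP[c cE].
have /eqP := apolar_msupp_neq0 char0 mF; case; rewrite cE linear_sum.
apply: big1 => j _; rewrite /= mulrC apolar_linear_formXM iter_dirderX //.
  rewrite /apolar big1 // => m _.
  by rewrite raddf0 mcoeff0 mulr0.
exact: dirder2_quadric.
Qed.

(** * Spanning a homogeneous component is an open condition *)

Section Generic.
Variables (k : fieldType) (n N : nat).

Definition monomials : seq 'X_{1..n} :=
  [seq val m | m <- enum {: 'X_{1..n < N.+1}} & mdeg (val m) == N].

Lemma mem_monomials m : (m \in monomials) = (mdeg m == N).
Proof.
apply/mapP/idP => [[x]|mN]; first by rewrite mem_filter => /andP[xN _] ->.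
have mlt : (mdeg m < N.+1)%N by rewrite (eqP mN).
by exists (BMultinom mlt); rewrite // mem_filter mem_enum /= mN.
Qed.

Lemma monomials_uniq : uniq monomials.
Proof.
by rewrite map_inj_uniq; [apply/filter_uniq/enum_uniq | apply: val_inj].
Qed.

Lemma dhomog_monomialsP (f g : {mpoly k[n]}) :
  f \is N.-homog -> g \is N.-homog ->
  (forall m, m \in monomials -> f@_m = g@_m) -> f = g.
Proof.
move=> hf hg fg; apply/mpolyP => m; have [/fg//|mN] := boolP (m \in monomials).
rewrite mem_monomials in mN.
by rewrite (dhomog_nemf_coeff hf) // (dhomog_nemf_coeff hg).
Qed.

Variables (T : Type) (M : nat) (pt : T -> 'I_M -> k).
Variables (I : finType) (G : I -> {mpoly {mpoly k[M]}[n]}).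
Let spec a i := map_mpoly (meval (pt a)) (G i).

(** Spanning means that the matrix of coefficients has full column rank. A maximal minor that is
    nonzero at [a0] is a polynomial in the parameters, and spanning persists wherever it does not
    vanish. *)
Lemma spanning_locus_open (a0 : T) :
  (forall a i, spec a i \is N.-homog) ->
  (forall f, f \is N.-homog ->
     exists c : I -> k, f = \sum_i c i *: spec a0 i) ->
  exists2 p : {mpoly k[M]}, p.@[pt a0] != 0 &
    forall a, p.@[pt a] != 0 -> forall f, f \is N.-homog ->
      exists c : I -> k, f = \sum_i c i *: spec a i.
Proof.
move=> specN span0; pose mon (j : 'I_(size monomials)) := nth 0%MM monomials j.
pose A : 'M[{mpoly k[M]}]_(#|I|, size monomials) :=
  \matrix_(i, j) (G (enum_val i))@_(mon j).
have AE a i j : map_mx (meval (pt a)) A i j = (spec a (enum_val i))@_(mon j).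
  by rewrite !mxE mcoeff_map_mpoly.
have combE a (c : I -> k) (j : 'I_(size monomials)) :
    (\sum_i c i *: spec a i)@_(mon j) =
    ((\row_i c (enum_val i)) *m map_mx (meval (pt a)) A) 0 j.
  rewrite raddf_sum /= mxE (reindex (@enum_val I predT)) /=; last first.
    by apply/onW_bij/enum_val_bij.
  by apply: eq_bigr => i _; rewrite AE mxE mcoeffZ.
have A0full : row_full (map_mx (meval (pt a0)) A).
  rewrite -sub1mx; apply/row_subP => j.
  have [|c cE] := span0 'X_[mon j].
    by rewrite dhomogX /= -mem_monomials mem_nth.
  apply/submxP; exists (\row_i c (enum_val i)); apply/rowP => j'.
  rewrite -combE -cE mcoeffX !mxE; congr (_%:R).
  by rewrite nth_uniq ?monomials_uniq.
(* [F] selects rows forming an invertible square block at [a0]; the determinant of the same rows of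
   the generic matrix is the polynomial sought. *)
pose F := fullrankfun A0full.
have detE a : (\det (rowsub F A)).@[pt a] =
    \det (rowsub F (map_mx (meval (pt a)) A)).
  by rewrite -det_map_mx map_mxsub.
exists (\det (rowsub F A)).
  by rewrite detE -unitfE -unitmxE -row_full_unit fullrowsub_full.
move=> a; rewrite detE -unitfE -unitmxE -row_full_unit => Ffull f hf.
have Afull : row_full (map_mx (meval (pt a)) A).
  by rewrite -sub1mx (submx_trans _ (rowsub_sub F _)) ?sub1mx.
have /submxP[D DE] : (\row_j f@_(mon j) <= map_mx (meval (pt a)) A)%MS.
  exact: submx_full.
exists (fun i => D 0 (enum_rank i)); apply: dhomog_monomialsP => //.
  by apply: rpred_sum => i _; apply/rpredZ/specN.
move=> m mB.
have mlt : (index m monomials < size monomials)%N by rewrite index_mem.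
have -> : m = mon (Ordinal mlt) by rewrite /mon nth_index.
rewrite combE; move/rowP/(_ (Ordinal mlt)): DE; rewrite mxE => ->.
by congr (_ 0 _); congr (_ *m _); apply/rowP => i; rewrite mxE enum_valK.
Qed.

End Generic.

(** * Linear forms with indeterminate coefficients *)

Section GenericForms.
Variables (k : fieldType) (n r d e : nat).

Definition generic_form (j : 'I_r) : {mpoly {mpoly k[r * n]}[n]} :=
  \sum_(i < n) 'X_(mxvec_index j i) *: 'X_i.

Lemma map_generic_form (a : 'M[k]_(r, n)) j :
  map_mpoly (meval (fun t => mxvec a 0 t)) (generic_form j) =
    linear_form (row j a).
Proof.
rewrite raddf_sum; apply: eq_bigr => i _ /=.
by rewrite map_mpolyZ map_mpolyX /= mevalXU mxvecE mxE.
Qed.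

Lemma generic_powers_span (a0 : 'M[k]_(r, n)) :
  (forall f, f \is (d + e).-homog -> exists c : 'I_r -> {mpoly k[n]},
     (forall j, c j \is e.-homog) /\
     f = \sum_j c j * linear_form (row j a0) ^+ d) ->
  exists2 p : {mpoly k[r * n]}, p.@[fun t => mxvec a0 0 t] != 0 &
    forall a, p.@[fun t => mxvec a 0 t] != 0 ->
      forall f, f \is (d + e).-homog ->
      f \in gen_ideal (fun j => linear_form (row j a) ^+ d).
Proof.
move=> span0.
(* The index type contains all monomials of degree at most [e]; those of lower degree get the value
   0, so that every member is homogeneous of degree [d + e]. *)
pose G (x : 'I_r * 'X_{1..n < e.+1}) : {mpoly {mpoly k[r * n]}[n]} :=
  if mdeg x.2 == e then generic_form x.1 ^+ d * 'X_[x.2] else 0.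
pose g (a : 'M[k]_(r, n)) (x : 'I_r * 'X_{1..n < e.+1}) : {mpoly k[n]} :=
  if mdeg x.2 == e then linear_form (row x.1 a) ^+ d * 'X_[x.2] else 0.
have GE a x : map_mpoly (meval (fun t => mxvec a 0 t)) (G x) = g a x.
  rewrite /G /g; case: ifP => _; last exact: raddf0.
  by rewrite rmorphM rmorphXn /= map_generic_form map_mpolyX.
have gh a x : g a x \is (d + e).-homog.
  rewrite /g; case: ifP => [me|_]; last exact: rpred0.
  apply: dhomogM; last by rewrite dhomogX.
  by have := dhomogMn d (dhomog_linear_form (row x.1 a)); rewrite mul1n.
have [||p p0 pP] := @spanning_locus_open k n (d + e) _ (r * n)
  (fun (a : 'M[k]_(r, n)) t => mxvec a 0 t) _ G a0.
- by move=> a x; rewrite GE.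
- move=> f /span0[c [ch ->]].
  exists (fun x : 'I_r * 'X_{1..n < e.+1} => (c x.1)@_x.2).
  under [RHS]eq_bigr do rewrite GE.
  rewrite -(pair_bigA _ (fun j m => (c j)@_(val m) *: g a0 (j, m))) /=.
  apply: eq_bigr => j _; rewrite [c j in LHS](mpolywE (k := e.+1)); last first.
    rewrite msizeE; apply/bigmax_leqP_seq => m mc _.
    by rewrite (dhomog_mf (ch j) mc).
  rewrite mulr_suml; apply: eq_bigr => m _; rewrite /g /=.
  case: eqP => [_|/eqP me]; first by rewrite -scalerAl mulrC.
  by rewrite (dhomog_nemf_coeff (ch j)) // !scale0r mul0r.
exists p => // a pa f fh; have [c ->] := pP a pa f fh.
apply: rpred_sum => x _; rewrite GE -mul_mpolyC; apply: gen_idealMl.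
rewrite /g; case: ifP => _; last exact: rpred0.
rewrite mulrC; apply: gen_idealMl; apply/gen_idealP.
exists (fun j => (j == x.1)%:R).
rewrite (bigD1 x.1) //= eqxx mul1r big1 ?addr0 // => j /negbTE->.
by rewrite mul0r.
Qed.

End GenericForms.

(** * Finitely generated subspaces have a dimension *)

Section Dimension.
Variables (k : fieldType) (V : lmodType k).

Lemma has_dim_eq (W W' : V -> Prop) N :
  (forall x, W x <-> W' x) -> has_dim W N -> has_dim W' N.
Proof.
move=> WW' [b [bW bP]]; exists b; split=> [j|x /WW' /bP //].
exact/WW'/bW.
Qed.

Lemma has_dim0 (W : V -> Prop) : (forall x, W x -> x = 0) -> has_dim W 0.
Proof.
move=> W0; exists (fun=> 0); split=> [[]//|x /W0 ->].
exists [ffun=> 0]; split; first by rewrite big_ord0.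
by move=> c _; apply/ffunP => -[].
Qed.

Lemma has_dim_gt0 (W : V -> Prop) N x :
  has_dim W N -> W x -> x != 0 -> (0 < N)%N.
Proof.
case: N => // -[b [_ bP]] /bP[c [-> _]]; by rewrite big_ord0 eqxx.
Qed.

(** Induction on the number of generators: the first one is added to a basis of the span of the
    others exactly when it lies outside that span. *)
Lemma has_dim_span_ord m (b : 'I_m -> V) :
  exists N, has_dim (fun x => exists c : 'I_m -> k, x = \sum_j c j *: b j) N.
Proof.
elim: m b => [|m IH] b.
  by exists 0%N; apply: has_dim0 => x [c ->]; rewrite big_ord0.
have [N [b' [b'W b'P]]] := IH (fun j => b (lift ord0 j)).
pose W x := exists c : 'I_m -> k, x = \sum_j c j *: b (lift ord0 j).
have WE (c : 'I_N -> k) : W (\sum_j c j *: b' j).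
  have [d dE] := boolp.choice b'W.
  exists (fun i => \sum_j c j * d j i).
  under eq_bigr do rewrite dE scaler_sumr.
  rewrite exchange_big; apply: eq_bigr => i _; rewrite scaler_suml.
  by apply: eq_bigr => j _; rewrite scalerA.
have WB x y : W x -> W y -> W (x - y).
  move=> [c ->] [d ->]; exists (fun j => c j - d j).
  by rewrite -sumrB; apply: eq_bigr => j _; rewrite scalerBl.
have WZ a x : W x -> W (a *: x).
  move=> [c ->]; exists (fun j => a * c j).
  by rewrite scaler_sumr; apply: eq_bigr => j _; rewrite scalerA.
case: (boolp.EM (W (b ord0))) => [b0W|b0W].
  exists N; apply: (@has_dim_eq W); last by exists b'.
  move=> x; split=> [[c ->]|[c ->]].
    exists (fun j => if unlift ord0 j is Some i then c i else 0).
    rewrite big_ord_recl unlift_none scale0r add0r.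
    by apply: eq_bigr => j _; rewrite liftK.
  rewrite big_ord_recl -[X in X + _]opprK addrC.
  apply: WB; first by exists (fun j => c (lift ord0 j)).
  by rewrite -scaleNr; apply: WZ.
pose b2 (j : 'I_N.+1) := if unlift ord0 j is Some i then b' i else b ord0.
have b2E (c : 'I_N.+1 -> k) :
    \sum_j c j *: b2 j = c ord0 *: b ord0 + \sum_j c (lift ord0 j) *: b' j.
  rewrite big_ord_recl /b2 unlift_none; congr (_ + _).
  by apply: eq_bigr => j _; rewrite liftK.
exists N.+1, b2; split=> [j|x [c ->]].
  rewrite /b2; case: unliftP => [i _|_].
    have [d ->] := b'W i.
    exists (fun j => if unlift ord0 j is Some i then d i else 0).
    rewrite big_ord_recl unlift_none scale0r add0r.
    by apply: eq_bigr => l _; rewrite liftK.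
  exists (fun j => (j == ord0)%:R).
  rewrite (bigD1 ord0) //= scale1r big1 ?addr0 // => l /negbTE->.
  by rewrite scale0r.
rewrite big_ord_recl.
have [d [dE dU]] := b'P _ (ex_intro _ (fun j => c (lift ord0 j)) erefl).
exists [ffun j => if unlift ord0 j is Some i then d i else c ord0]; split.
  rewrite b2E ffunE unlift_none; congr (_ + _); rewrite dE.
  by apply: eq_bigr => j _; rewrite ffunE liftK.
move=> e; rewrite b2E => eE.
(* Otherwise, dividing by the difference of the two coefficients would put [b ord0] in [W]. *)
have ce : c ord0 = e ord0.
  apply/eqP; apply: contra_notT b0W; rewrite -subr_eq0 => ce.
  rewrite -[b ord0]scale1r -(mulVf ce) -scalerA; apply: WZ.
  have -> : (c ord0 - e ord0) *: b ord0 = \sum_j e (lift ord0 j) *: b' j -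
      \sum_j c (lift ord0 j) *: b (lift ord0 j).
    rewrite scalerBl; set w := \sum_j c _ *: _; rewrite -/w in eE.
    by rewrite -[c ord0 *: _](addrK w) eE addrAC [e _ *: _ + _]addrC addrK.
  by apply: WB; [apply: WE | exists (fun j => c (lift ord0 j))].
have /dU de : \sum_j c (lift ord0 j) *: b (lift ord0 j) =
    \sum_j [ffun j => e (lift ord0 j)] j *: b' j.
  apply: (addrI (c ord0 *: b ord0)); rewrite eE ce; congr (_ + _).
  by apply: eq_bigr => j _; rewrite ffunE.
apply/ffunP => j; rewrite ffunE; case: unliftP => [i ->|->//].
by rewrite de ffunE.
Qed.

Lemma has_dim_span (I : finType) (b : I -> V) :
  exists N, has_dim (fun x => exists c : I -> k, x = \sum_i c i *: b i) N.
Proof.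
have [N NP] := has_dim_span_ord (fun j => b (@enum_val I predT j)).
have bijI := onW_bij predT (enum_val_bij I).
exists N; apply: has_dim_eq NP => x; split=> -[c ->].
  exists (fun i => c (enum_rank i)); rewrite [RHS](reindex _ bijI).
  by apply: eq_bigr => j _; rewrite enum_valK.
by exists (fun j => c (enum_val j)); rewrite (reindex _ bijI).
Qed.

End Dimension.

(** * From membership in the ideal to the Hilbert series *)

Section HilbertSeries.
Variables (k : fieldType) (n m : nat) (g : 'I_m -> {mpoly k[n]}).
Local Notation pi := (mpoly_quot_pi g).

Lemma mpoly_quot_pi_is_linear : linear pi.
Proof.
by move=> a f h; rewrite mpoly_quot_piD -mpoly_quot_piZ.
Qed.

HB.instance Definition _ := GRing.isLinear.Build k {mpoly k[n]} (mpoly_quot g) _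
  pi mpoly_quot_pi_is_linear.

Lemma mpoly_quot_pi_eq0 f : (pi f == 0) = (f \in gen_ideal g).
Proof.
by rewrite -(raddf0 pi) -[f in RHS]subr0; apply/eqP/mpoly_quot_piP.
Qed.

Lemma mpoly_quot_piece_finite i :
  exists N, has_dim (@mpoly_quot_piece k n m g i) N.
Proof.
pose b (t : 'X_{1..n < i.+1}) := if mdeg t == i then pi 'X_[t] else 0.
have [N NP] := has_dim_span b; exists N; apply: has_dim_eq NP => x; split.
  move=> [c ->].
  exists (\sum_(t : 'X_{1..n < i.+1} | mdeg t == i) c t *: 'X_[t]).
    by apply: rpred_sum => t ti; apply: rpredZ; rewrite dhomogX.
  rewrite raddf_sum [RHS]big_mkcond; apply: eq_bigr => t _; rewrite /b.
  by case: ifP => _; rewrite ?scaler0 //= linearZ.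
move=> [f fi ->]; exists (fun t : 'X_{1..n < i.+1} => f@_t).
rewrite [f in LHS](mpolywE (k := i.+1)).
  rewrite raddf_sum; apply: eq_bigr => t _; rewrite /= linearZ /b /=.
  case: eqP => // /eqP ti.
  by rewrite (dhomog_nemf_coeff fi) // !scale0r.
rewrite msizeE; apply/bigmax_leqP_seq => t tf _.
by rewrite (dhomog_mf fi tf).
Qed.

(** The dimensions of the pieces, cut off after degree [s], form [H]: the later pieces vanish, and
    the class of ['X_[t]] makes the coefficient in degree [s] positive. *)
Lemma hilbert_series_of_socle_degree s (t : 'X_{1..n}) :
  (forall i f, (s < i)%N -> f \is i.-homog -> f \in gen_ideal g) ->
  mdeg t = s -> 'X_[t] \notin gen_ideal g ->
  exists H : {poly nat},
    [/\ is_hilbert_series g H, size H = s.+1 & (1 <= lead_coef H)%N].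
Proof.
move=> gs ts tg; have [N NP] := boolp.choice mpoly_quot_piece_finite.
have Ns : (0 < N s)%N.
  apply: (has_dim_gt0 (x := pi 'X_[t]) (NP s)).
    by exists 'X_[t] => //; rewrite dhomogX /= ts.
  by rewrite mpoly_quot_pi_eq0.
exists (\poly_(i < s.+1) N i).
have sz : size (\poly_(i < s.+1) N i) = s.+1 by rewrite size_poly_eq // -lt0n.
split=> //; last by rewrite lead_coefE sz coef_poly ltnSn.
move=> i; rewrite coef_poly; case: ifP => [//|/negbT].
rewrite -leqNgt => si; apply: has_dim0 => x [f fi ->].
by apply/eqP; rewrite mpoly_quot_pi_eq0 (gs i).
Qed.

End HilbertSeries.

(** * Nine general forms in four variables *)

Lemma gen_ideal_dhomog_ge (k : fieldType) n m (g : 'I_m -> {mpoly k[n]}) N :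
  (forall f, f \is N.-homog -> f \in gen_ideal g) ->
  forall i f, (N <= i)%N -> f \is i.-homog -> f \in gen_ideal g.
Proof.
(* Induction on the excess [i] of the degree over [N]: a monomial of larger degree is a variable
   times one of degree one less. *)
move=> gN; have X i t : mdeg t = (N + i)%N -> 'X_[t] \in gen_ideal g.
  elim: i t => [|i IH] t td; first by apply: gN; rewrite dhomogX /= td addn0.
  have [j tj] : exists j, t j != 0%N.
    apply/existsP; apply: contra_eqT td; rewrite negb_exists => /forallP t0.
    rewrite mdegE big1 ?addnS // => j _; apply/eqP; have := t0 j.
    by rewrite negbK.
  have tE : (t - U_(j) + U_(j))%MM = t.
    apply: submK; apply/mnm_lepP => l; rewrite mnm1E.
    by case: eqP => // <-; rewrite lt0n.
  rewrite -tE mpolyXD mulrC; apply/gen_idealMl/IH.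
  by have := mdegD (t - U_(j)) U_(j); rewrite tE td mdeg1; lia.
move=> i f Ni fi; rewrite [f]mpolyE big_seq; apply: rpred_sum => t tf.
rewrite -mul_mpolyC; apply/gen_idealMl/(X (i - N)%N).
by rewrite (dhomog_mf fi tf) subnKC.
Qed.

Lemma special_span (k : fieldType) e : [pchar k] =i pred0 ->
  exists a : 'M[k]_(9, 4), forall f, f \is (e.+1 + e).-homog ->
    exists c : 'I_9 -> {mpoly k[4]},
      (forall j, c j \is e.-homog) /\
      f = \sum_j c j * linear_form (row j a) ^+ e.+1.
Proof.
move=> char0; pose T := (bool * bool * bool)%type.
have cardT : (#|{: T}| <= 9)%N by rewrite !card_prod card_bool.
pose pos (x : T) := widen_ord cardT (enum_rank x).
have pos_inj : injective pos.
  by move=> x y /(congr1 val) /= /val_inj /enum_rank_inj.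
(* The eight forms occupy eight of the nine rows; the remaining row is zero. *)
pose a : 'M[k]_(9, 4) := \matrix_(j < 9)
  (if [pick x | pos x == j] is Some x then special_form k x else 0).
have rowa x : row (pos x) a = special_form k x.
  rewrite rowK; case: pickP => [y /eqP/pos_inj->//|/(_ x)].
  by rewrite eqxx.
exists a => f fh; have : f \is (e.*2.+1).-homog by rewrite -addnn -addSn.
move=> /(power_span_special char0)[c [ch _ ->]].
(* By injectivity of [pos] the sum has at most one term; it is empty at the zero row. *)
exists (fun j => \sum_(x | pos x == j) c x); split.
  by move=> j; apply: rpred_sum => x _; apply: ch.
rewrite (partition_big pos predT) //=; apply: eq_bigr => j _.
by rewrite mulr_suml; apply: eq_bigr => x /eqP <-; rewrite rowa.
Qed.

Theorem proposition8p7 (k : fieldType) (hk : [pchar k] =i pred0)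
    (d : nat) (hd : (1 <= d)%N) :
  for_general_linear_forms (fun l : 'I_9 -> {mpoly k[4]} =>
    exists H : {poly nat},
      [/\ is_hilbert_series (fun j => l j ^+ d) H,
          size H = (2 * (d - 1)).+1%N &
          (1 <= lead_coef H)%N]).
Proof.
case: d hd => // e _; rewrite subn1 /= mul2n.
have [a0 a0span] := special_span e hk.
have [p p0 pP] := generic_powers_span a0span.
exists (fun a => p.@[fun t => mxvec a 0 t] != 0); split.
- exists (fun f => f = p) => a; split=> [pa|[f -> //]].
  by exists p.
- by exists a0.
move=> a pa.
(* The side condition is 9 < 10, the number of quadratic monomials in four variables. *)
have [|t td tI] := @monomial_notin_ideal k 3 9 (fun j => row j a) e hk.
  by [].
apply: (hilbert_series_of_socle_degree _ td tI) => i f ei.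
(* Only degree [2e + 1 = (e + 1) + e] has to be treated, and there [p] being nonzero at [a]
   suffices. *)
apply: gen_ideal_dhomog_ge ei => {}f fh; apply: pP => //.
by rewrite addSn addnn.
Qed.
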